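(* Let $A\in\mathbb{Z}^{r\times n}$, $\mathbf{b}\in\mathbb{Z}^r$, and let $\mathcal{P}=\{\alpha\in\mathbb{R}^n_{\ge 0}: A\alpha=\mathbf{b}\}$ be bounded (a rational convex polytope) of dimension $d$. Let $$Ehr_{\mathcal{P}}(\mathbf{y};t)=\sum_{s\ge 0}\ \sum_{\alpha\in s\mathcal{P}\cap\mathbb{N}^n}\mathbf{y}^{\alpha}t^s ,$$ and suppose that, as rational functions, $$Ehr_{\mathcal{P}}(\mathbf{y};t)=\sum_i F_i(\mathbf{y};t),\qquad F_i(\mathbf{y};t)=\frac{L_i(\mathbf{y};t)}{\prod_{k=1}^{h_i}\bigl(1-\mathbf{y}^{\nu_{i,k}}t^{m_{i,k}}\bigr)},$$ (a finite sum) where $h_i\le d+1$, $\nu_{i,k}\in\mathbb{Z}^n$, $m_{i,k}\in\mathbb{Z}$, and $L_i(\mathbf{y};t)$ are Laurent polynomials. If $\beta\in\mathbb{Z}^n$ is admissible for all $F_i$, then $$\mathrm{vol}(\mathcal{P})=\frac{1}{d!}\sum_i \mathrm{Vol}_d^{\beta}F_i(\mathbf{y};t).$$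
   Context: $\mathbf{y}^\alpha=y_1^{\alpha_1}\cdots y_n^{\alpha_n}$, $s\mathcal{P}=\{s\alpha:\alpha\in\mathcal{P}\}$. The volume $\mathrm{vol}(\mathcal{P})$ is the relative volume: $\mathrm{vol}(\mathcal{P})=\lim_{s\to\infty}s^{-d}\,\#(s\mathcal{P}\cap\mathbb{Z}^n)$ ($s$ running over positive integers); for full-dimensional $\mathcal{P}$ it equals the Lebesgue volume. For $F(\mathbf{y};t)=L(\mathbf{y};t)/\prod_{k=1}^{h}(1-\mathbf{y}^{\nu_k}t^{m_k})$ with $h\le d+1$, a vector $\beta\in\mathbb{Z}^n$ is admissible for $F$ if for every $k$ the numbers $\beta^T\nu_k$ and $m_k$ are not both $0$. Its $\beta$ algebraic volume is $\mathrm{Vol}_d^\beta F:=\mathrm{CT}_q \dfrac{L(\mathbf{1};1)}{\prod_{k=1}^{d+1}(m_k-(\beta^T\nu_k)q)}$ if $h=d+1$, and $\mathrm{Vol}_d^\beta F:=0$ if $h<d+1$; here $\mathrm{CT}_q$ denotes the constant term (coefficient of $q^0$) of the Laurent series expansion in $q$ at $q=0$.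
   Formalization: The formal theorem additionally assumes that the limit defining vol(P) exists; for some rational polytopes it does not (e.g. P = {1/2}, given by 2α = 1, d = 0, with lattice counts alternating between 0 and 1), so vol(P) is then undefined. *)

(* Defs.v *)
From HB Require Import structures.
From mathcomp Require Import all_boot all_order all_algebra.
From mathcomp Require Import finmap fraction complex.
From mathcomp Require Import all_classical all_reals all_analysis.
(* The notations of mpoly clash with those of mathcomp-analysis; below
   [mpoly n K] is {mpoly K[n]}, [multinom n] is 'X_{1..n}, [mpolyX K m] is
   'X_[m] and [mnm1 j] is U_(j). *)
From mathcomp Require Import -(notations) mpoly.

Set Implicit Arguments.
Unset Strict Implicit.
Unset Printing Implicit Defensive.

Import GRing.Theory Num.Theory numFieldNormedType.Exports.

Local Open Scope classical_set_scope.
Local Open Scope ring_scope.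

Section Polytopes.
Variables (R : realType) (n : nat).

Definition polytope (r : nat) (A : 'M[int]_(r, n)) (b : 'cV[int]_r) :
    set 'cV[R]_n :=
  [set x : 'cV[R]_n | (forall j, 0 <= x j 0) /\ map_mx intr A *m x = map_mx intr b].

Definition affine_hull (P : set 'cV[R]_n) : set 'cV[R]_n :=
  [set x | exists (k : nat) (c : 'I_k -> R) (p : 'I_k -> 'cV[R]_n),
     [/\ forall i, P (p i), \sum_i c i = 1 & x = \sum_i c i *: p i]].

(* The affine hull is a translate of a d-dimensional linear subspace; in
   particular P is nonempty. *)
Definition has_dim (P : set 'cV[R]_n) (d : nat) : Prop :=
  exists (x0 : 'cV[R]_n) (V : {vspace 'cV[R]_n}),
    affine_hull P = [set x | x - x0 \in V] /\ \dim V = d.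

Definition dilate (s : nat) (P : set 'cV[R]_n) : set 'cV[R]_n :=
  [set s%:R *: x | x in P].

(* [fset_set A] is the finite set A when A is finite, as it is here for
   bounded P (and the empty set otherwise). *)
Definition lattice_count (P : set 'cV[R]_n) : nat :=
  #|` fset_set [set a : 'cV[int]_n | P (map_mx intr a)]|.

(* The term s = 0 is irrelevant to the limit. *)
Definition lattice_density (d : nat) (P : set 'cV[R]_n) (s : nat) : R :=
  s%:R ^- d * (lattice_count (dilate s P))%:R.

Definition rel_vol (d : nat) (P : set 'cV[R]_n) : R :=
  limn (lattice_density d P).

(* The coefficient of t^s in the Ehrhart series of P, a polynomial in y. *)
Definition ehrhart_series (K : comNzRingType) (P : set 'cV[R]_n) (s : nat) :
    mpoly n K :=
  \sum_(a <- fset_set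
          [set a : multinom n | dilate s P (\col_(j < n) (a j)%:R)])
    mpolyX K a.

End Polytopes.

Arguments polytope R {n r} A b.

Local Notation "x %:F" := (tofrac x) : ring_scope.

Section RationalFunctions.
Variables (K : fieldType) (n : nat).

(* K(y_1, ..., y_n, t), with t the outer variable. *)
Local Notation ratfun := {fraction {poly (mpoly n K)}}.

Definition var_y (j : 'I_n) : ratfun := ((mpolyX K (mnm1 j))%:P)%:F.
Definition var_t : ratfun := ('X)%:F.
Definition ratfunC (c : K) : ratfun := ((mpolyC n c)%:P)%:F.

Definition lmonom (nu : 'cV[int]_n) (m : int) : ratfun :=
  (\prod_(j < n) var_y j ^ nu j 0) * var_t ^ m.

(* The power series sum_s (E s) t^s is the rational function f: for some
   fraction p / g representing f, g * E = p as power series in t. *)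
Definition series_eq_ratfun (E : nat -> mpoly n K) (f : ratfun) : Prop :=
  exists p g : {poly (mpoly n K)},
    [/\ g != 0, f = p%:F / g%:F
      & forall s : nat, \sum_(i < s.+1) g`_i * E (s - i)%N = p`_s].

(* L (a, e) is the coefficient of y^a t^e. *)
Definition laurent := {fsfun 'cV[int]_n * int -> K with 0}.

Definition laurent_ratfun (L : laurent) : ratfun :=
  \sum_(e <- finsupp L) ratfunC (L e) * lmonom e.1 e.2.

Definition laurent_at1 (L : laurent) : K := \sum_(e <- finsupp L) L e.

(* The data of L / prod_(k < nfac) (1 - y^(fnu k) t^(fexp k)). *)
Record fterm := FTerm {
  fnum : laurent;
  nfac : nat;
  fnu : 'I_nfac -> 'cV[int]_n;
  fexp : 'I_nfac -> int }.

Definition fterm_ratfun (F : fterm) : ratfun :=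
  laurent_ratfun (fnum F) / \prod_(k < nfac F) (1 - lmonom (fnu k) (fexp k)).

Definition pairing (beta v : 'cV[int]_n) : int := (beta^T *m v) 0 0.

Definition admissible (beta : 'cV[int]_n) (F : fterm) : Prop :=
  forall k : 'I_(nfac F), ~ (pairing beta (fnu k) = 0 /\ fexp k = 0).

(* c is the family of coefficients of the Laurent expansion of f at q = 0:
   c vanishes far to the left and g * c = p for some p / g representing f. *)
Definition laurent_expansion (f : {fraction {poly K}}) (c : int -> K) : Prop :=
  (exists N : int, forall j : int, j < N -> c j = 0) /\
  exists p g : {poly K},
    [/\ g != 0, f = p%:F / g%:F
      & forall j : int, \sum_(i < size g) g`_i * c (j - i%:Z) =
          (if j is Posz k then p`_k else 0)].

(* The expansion exists and is unique, so the choice made by [xget] is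
   immaterial. *)
Definition CT (f : {fraction {poly K}}) : K :=
  xget 0 [set v | exists2 c, laurent_expansion f c & v = c 0].

Definition alg_vol (d : nat) (beta : 'cV[int]_n) (F : fterm) : K :=
  if nfac F == d.+1 then
    CT (((laurent_at1 (fnum F))%:P)%:F /
        (\prod_(k < nfac F)
           ((fexp k)%:~R%:P - (pairing beta (fnu k))%:~R *: 'X))%:F)
  else 0.

End RationalFunctions.

(* Main.v *)
(* Restrict everything to the curve [y_j = u ^ (- beta_j)], [t = u ^ M] with [M]
   a large integer and [0 < u < 1].  There the Ehrhart series converges, and the
   fraction [F_i] becomes a fraction with denominator
   [\prod_k (1 - u ^ (m_k M - <beta, nu_k>))]; admissibility makes all these
   exponents nonzero.  Multiplying by [(1 - u) ^ d.+1] and letting [u] tend to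
   [1], the right-hand side tends to
   [\sum_i L_i(1; 1) / \prod_k (m_k M - <beta, nu_k>)], the sum being over the
   terms with [d + 1] factors, i.e. to [M ^- d.+1] times the value at [q = 1 / M]
   of the rational function [G] whose constant term is sought.
   Since [|<beta, alpha>| <= C s] on [s P], the left-hand side is squeezed between
   the series of [#(s P) x ^ s] at [x = u ^ (M + C)] and at [x = u ^ (M - C)], and
   Abel's theorem evaluates both limits: [d! vol(P) / (M +- C) ^ d.+1].
   Hence [G (1 / M)] tends to [d! vol(P)] as [M] tends to infinity, so the polar
   parts of the summands of [G] cancel and its constant term is [d! vol(P)]. *)

Require Import Defs.
From HB Require Import structures.
From mathcomp Require Import all_boot all_order all_algebra.
From mathcomp Require Import finmap fraction complex.
From mathcomp Require Import all_classical all_reals all_analysis.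
From mathcomp Require Import zify ring.
From mathcomp Require Import -(notations) mpoly.
Import Order.TTheory GRing.Theory Num.Theory numFieldNormedType.Exports.
Local Open Scope classical_set_scope.
Local Open Scope ring_scope.

Set Implicit Arguments.
Unset Strict Implicit.
Unset Printing Implicit Defensive.

(** * Limits in numeric fields and in the complex numbers *)

Lemma sub1rX (K : pzRingType) (x : K) (n : nat) :
  1 - x ^+ n = (1 - x) * \sum_(i < n) x ^+ i.
Proof. by rewrite -opprB subrX1 -mulNr opprB. Qed.

Section FieldLimits.
Variables (K : numFieldType) (T : Type) (F : set_system T).
Context {FF : Filter F}.

Lemma cvg_bigsum (I : Type) (s : seq I) (P : pred I) (f : I -> T -> K)
    (l : I -> K) :
  (forall i, P i -> f i x @[x --> F] --> l i) ->
  \sum_(i <- s | P i) f i x @[x --> F] --> \sum_(i <- s | P i) l i.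
Proof.
move=> fl; elim: s => [|i s IHs].
  by under eq_fun do rewrite big_nil; rewrite big_nil; apply: cvg_cst.
rewrite big_cons; under eq_fun do rewrite big_cons.
by case: ifPn => // Pi; apply: cvgD => //; apply: fl.
Qed.

Lemma cvg_bigprod (I : Type) (s : seq I) (P : pred I) (f : I -> T -> K)
    (l : I -> K) :
  (forall i, P i -> f i x @[x --> F] --> l i) ->
  \prod_(i <- s | P i) f i x @[x --> F] --> \prod_(i <- s | P i) l i.
Proof.
move=> fl; elim: s => [|i s IHs].
  by under eq_fun do rewrite big_nil; rewrite big_nil; apply: cvg_cst.
rewrite big_cons; under eq_fun do rewrite big_cons.
by case: ifPn => // Pi; apply: cvgM => //; apply: fl.
Qed.

Lemma cvg_exprn (f : T -> K) (a : K) (k : nat) :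
  f x @[x --> F] --> a -> f x ^+ k @[x --> F] --> a ^+ k.
Proof.
move=> fa; elim: k => [|k IHk]; first by under eq_fun do rewrite expr0; apply: cvg_cst.
by rewrite exprS; under eq_fun do rewrite exprS; apply: cvgM.
Qed.

Lemma cvg_exprz (f : T -> K) (a : K) (z : int) : a != 0 ->
  f x @[x --> F] --> a -> f x ^ z @[x --> F] --> a ^ z.
Proof.
move=> a0 fa; case: z => k; first exact: cvg_exprn.
by apply: cvgV; [rewrite expf_neq0 | apply: cvg_exprn].
Qed.

Lemma cvg_horner (p : {poly K}) (f : T -> K) (a : K) :
  f x @[x --> F] --> a -> p.[f x] @[x --> F] --> p.[a].
Proof.
move=> fa; rewrite horner_coef; under eq_fun do rewrite horner_coef.
by apply: cvg_bigsum => i _; apply: cvgMl_tmp; apply: cvg_exprn.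
Qed.

(** For $e \ge 0$ the quotient is a geometric sum of $e$ terms, each tending to 1; the identity $1 -
    u^{-k} = -u^{-k}(1 - u^k)$ reduces negative exponents to this case. *)
Lemma cvg_subr1_exprz_ratio (u : T -> K) (e : int) :
  u x @[x --> F] --> (1 : K) -> (forall x, u x != 0) -> (forall x, u x != 1) ->
  (1 - u x ^ e) / (1 - u x) @[x --> F] --> (e%:~R : K).
Proof.
move=> u1 un0 un1.
have nat_case k : (1 - u x ^+ k) / (1 - u x) @[x --> F] --> (k%:R : K).
  have -> : (fun x => (1 - u x ^+ k) / (1 - u x)) = fun x => \sum_(i < k) u x ^+ i.
    by apply/funext => x; rewrite sub1rX mulrAC divff ?mul1r // subr_eq0 eq_sym.
  have -> : (k%:R : K) = \sum_(i < k) 1 ^+ i.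
    by under eq_bigr do rewrite expr1n; rewrite sumr_const card_ord.
  by apply: cvg_bigsum => i _; apply: cvg_exprn.
case: e => k; first exact: nat_case.
rewrite NegzE.
have -> : (fun x => (1 - u x ^ (- k.+1%:Z)) / (1 - u x)) =
    fun x => - u x ^ (- k.+1%:Z) * ((1 - u x ^+ k.+1) / (1 - u x)).
  apply/funext => x; rewrite -exprnN mulrA; congr (_ / _).
  by rewrite mulrBr mulr1 mulNr mulVf ?expf_neq0// opprK addrC.
rewrite (_ : (- k.+1%:Z)%:~R = - (1 : K) ^ (- k.+1%:Z) * k.+1%:R).
  by apply: cvgM => //; apply: cvgN; apply: cvg_exprz => //; exact: oner_neq0.
by rewrite exp1rz mulN1r mulrNz.
Qed.

End FieldLimits.

(** * Power series identities evaluated at a point of convergence *)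

Section SeriesLimits.
Variable K : numFieldType.

(* Partial sums of a Cauchy product with a polynomial: only finitely many
   shifted copies of the partial sums of the series occur. *)
Lemma cvg_series_mul_poly (g p : {poly K}) (e : nat -> K) (t w : K) :
  (forall s, \sum_(i < s.+1) g`_i * e (s - i)%N = p`_s) ->
  (\sum_(0 <= s < m) e s * t ^+ s @[m --> \oo] --> w) ->
  g.[t] * w = p.[t].
Proof.
move=> gep ew.
set S := fun m => \sum_(0 <= s < m) e s * t ^+ s.
(* Once [m] reaches both sizes, the combination of shifted partial sums is exactly [p.[t]], so its
   limit is known. *)
have SS m : (size p <= m)%N -> (size g <= m)%N ->
    \sum_(i < size g) g`_i * t ^+ i * S (m - i)%N = p.[t].
  move=> pm gm.
  have -> : p.[t] = \sum_(s < m) p`_s * t ^+ s by rewrite (horner_coef_wide t pm).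
  rewrite (big_ord_widen m (fun i => g`_i * t ^+ i * S (m - i)%N)) //.
  rewrite big_mkcond /= (eq_bigr (fun i : 'I_m => g`_i * t ^+ i * S (m - i)%N)); last first.
    by move=> i _; case: ifPn => //; rewrite -leqNgt => gi; rewrite nth_default ?mul0r.
  rewrite [RHS](eq_bigr (fun s : 'I_m => \sum_(i < m | (i <= s)%N)
      g`_i * t ^+ i * (e (s - i)%N * t ^+ (s - i)))); last first.
    move=> s _; rewrite -gep mulr_suml.
    rewrite (big_ord_widen m (fun i => g`_i * e (s - i)%N * t ^+ s)); last exact: ltn_ord.
    apply: eq_bigr => i; rewrite ltnS => is_.
    have -> : t ^+ s = t ^+ i * t ^+ (s - i) by rewrite -exprD subnKC.
    by rewrite mulrACA.
  rewrite (exchange_big_dep predT) //=; apply: eq_bigr => i _.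
  rewrite -mulr_sumr; congr (_ * _).
  rewrite -(big_mkord (fun s => (i <= s)%N) (fun s => e (s - i)%N * t ^+ (s - i))).
  rewrite (@big_cat_nat _ _ _ i) //=; last exact: ltnW.
  rewrite [X in X + _]big_nat_cond big_pred0 ?add0r; last first.
    by move=> j; apply/negbTE; lia.
  rewrite big_nat_cond (eq_bigl (fun j => (i <= j < m)%N)); last by move=> j; lia.
  rewrite -big_nat -{2}(add0n (i : nat)) big_addn /S.
  by apply: eq_bigr => j _; rewrite addnK.
have L : (\sum_(i < size g) g`_i * t ^+ i * S (m - i)%N) @[m --> \oo] -->
    \sum_(i < size g) g`_i * t ^+ i * w.
  apply: cvg_bigsum => i _; apply: cvgMl_tmp.
  by rewrite (cvg_centern i S).
rewrite horner_coef mulr_suml; apply: (cvg_unique _ L) => //.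
apply/(@cvg_near_cst _ _ _ _ _ _) => //.
near=> m; apply/esym; rewrite SS //; near: m; exact: nbhs_infty_ge.
Unshelve. all: by end_near. Qed.

End SeriesLimits.

(** * Passage between real and complex limits *)

Section ComplexLimits.
Variable R : realType.

Lemma cvg_real_complex (w : nat -> R) (l : R) : w j @[j --> \oo] --> l ->
  ((w j)%:C%C : (R[i] : numFieldType)) @[j --> \oo] --> (l%:C%C : (R[i] : numFieldType)).
Proof.
move=> wl; apply/cvgrPdist_lt => e; rewrite ltcE /= => /andP[/eqP Ime Ree].
move/cvgrPdist_lt : wl => /(_ _ Ree); apply: filterS => j wj.
by rewrite -rmorphB normc_def /= expr0n addr0 sqrtr_sqr ltcE /= Ime eqxx.
Qed.

(** The real line is closed in the complex plane: $|\mathrm{Im} H|$ is at most the distance from $H$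
    to any real number. *)
Lemma cvg_complex_real (w : nat -> R) (H : R[i]) :
  ((w j)%:C%C : (R[i] : numFieldType)) @[j --> \oo] --> (H : (R[i] : numFieldType)) ->
  w j @[j --> \oo] --> complex.Re H /\ H = (complex.Re H)%:C%C.
Proof.
move=> /cvgrPdist_lt wH.
have dist (e : R) : 0 < e -> \forall j \near \oo, `|H - (w j)%:C%C| < e%:C%C.
  by move=> e0; apply: wH; rewrite ltcR.
have WR : w j @[j --> \oo] --> complex.Re H.
  apply/cvgrPdist_lt => e /dist; apply: filterS => j wj.
  rewrite -ltcR; apply: le_lt_trans wj; apply: le_trans (normc_ge_Re _).
  by case: H {wH dist} => x y /=.
split=> //; suff : complex.Im H = 0 by case: H {wH dist WR} => x y /= ->.
apply/eqP; rewrite -normr_le0; apply/ler_addgt0Pr => e /dist [N _ /(_ N)].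
rewrite add0r => /(_ (leqnn N)) HN; rewrite ltW // -ltcR; apply: le_lt_trans HN.
rewrite normc_def lecR -sqrtr_sqr ler_sqrt ?addr_ge0 ?sqr_ge0 //.
by case: H {wH dist WR} => x y /=; rewrite subr0 lerDr sqr_ge0.
Qed.

End ComplexLimits.

(** * Constant terms of Laurent expansions *)

Section ConstantTerm.

Lemma poly_factor_Xn (K : fieldType) (g : {poly K}) : g != 0 ->
  exists a h, g = h * 'X^a /\ h`_0 != 0.
Proof.
move=> g0; have [a [h]] := multiplicity_XsubC g 0.
rewrite g0 /= subr0 => -[rh gE]; exists a, h; split => //.
by rewrite -horner_coef0; apply: rh.
Qed.

Lemma coef_mul_expn_small (K : fieldType) (p r : {poly K}) (k j : nat) :
  r`_0 = 0 -> (j < k)%N -> (p * r ^+ k)`_j = 0.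
Proof.
move=> r0 jk.
have /factor_theorem [q ->] : root r 0 by rewrite /root horner_coef0 r0.
by rewrite subr0 exprMn mulrA coefMXn jk.
Qed.

(* [h] is a unit times [1 - r] with [r] without constant term, so the quotient
   is read off the geometric series in [r]. *)
Lemma power_series_quotient (K : fieldType) (p h : {poly K}) : h`_0 != 0 ->
  exists e : nat -> K, forall j, \sum_(i < j.+1) h`_i * e (j - i)%N = p`_j.
Proof.
move=> h0; pose c := h`_0; pose r := 1 - c^-1 *: h.
have r0 : r`_0 = 0 by rewrite !coefE /= -/c mulVf ?subrr.
pose J m := \sum_(k < m) c^-1 *: (p * r ^+ k).
have hJ m : h * J m = p - p * r ^+ m.
  have -> : J m = (c^-1 *: p) * \sum_(k < m) r ^+ k.
    by rewrite mulr_sumr; apply: eq_bigr => k _; rewrite -scalerAl.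
  have hE : h = c *: (1 - r).
    by rewrite opprB addrC subrK scalerA mulfV ?scale1r.
  rewrite {1}hE -!scalerAl -scalerAr scalerA mulfV // scale1r.
  by rewrite mulrCA -sub1rX mulrBr mulr1.
have Jst m j : (j < m)%N -> (J m)`_j = (J j.+1)`_j.
  move=> jm; rewrite /J !coef_sum.
  rewrite -(big_mkord xpredT (fun k => (c^-1 *: (p * r ^+ k))`_j)).
  rewrite (@big_cat_nat _ _ _ j.+1) //= big_mkord.
  rewrite -[RHS]addr0; congr (_ + _); rewrite big_nat_cond.
  apply: big1 => k /andP[/andP[jk _] _].
  by rewrite coefZ coef_mul_expn_small // mulr0.
exists (fun j => (J j.+1)`_j) => j.
have := congr1 (fun q : {poly K} => q`_j) (hJ j.+1).
rewrite coefB (coef_mul_expn_small _ r0) // subr0 => <-; rewrite coefM.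
by apply: eq_bigr => i _; rewrite (@Jst j.+1) // ltnS leq_subr.
Qed.

(** Writing $g = h q^a$ with $h(0) \ne 0$, the expansion is the power series of $p / h$ shifted down
    by $a$. *)
Lemma laurent_expansion_exists (K : fieldType) (p g : {poly K}) : g != 0 ->
  exists c, laurent_expansion (tofrac p / tofrac g) c.
Proof.
move=> g0; have [a [h [gE h0]]] := poly_factor_Xn g0.
have [e he] := power_series_quotient p h0.
pose c (z : int) := if z + a%:Z is Posz k then e k else 0.
exists c; split.
  exists (- a%:Z) => j ja; rewrite /c.
  by case E : (j + a%:Z) => [k|k] //; exfalso; lia.
exists p, g; split => // j.
have szg : size g = (a + size h)%N.
  have hn0 : h != 0 by apply: contraNneq h0 => ->; rewrite coef0.
  by rewrite gE size_mulXn // addnC.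
rewrite szg big_split_ord /= big1 ?add0r; last first.
  by move=> i _; rewrite gE coefMXn ltn_ord mul0r.
rewrite (eq_bigr (fun i : 'I_(size h) =>
   h`_i * (if (j - i%:Z) is Posz k then e k else 0))); last first.
  move=> i _; rewrite gE coefMXn ltnNge leq_addr /= addKn /c.
  by rewrite (_ : j - (a + i)%N%:Z + a%:Z = j - i%:Z) //; lia.
case: j => k; last first.
  apply: big1 => i _; case E : (Negz k - i%:Z) => [l|l]; last by rewrite mulr0.
  by exfalso; move: E; rewrite NegzE; lia.
pose G i := h`_i * (if (k%:Z - i%:Z) is Posz l then e l else 0).
have GE m : (size h <= m)%N -> \sum_(i < size h) G i = \sum_(i < m) G i.
  move=> hm; rewrite (big_ord_widen m G) // big_mkcond /=.
  by apply: eq_bigr => i _; case: ifPn => //; rewrite -leqNgt => hi;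
     rewrite /G nth_default ?mul0r.
(* This bound covers both ranges, $i \le k$ and $i <$ [size h]; the terms outside either range
   vanish. *)
rewrite (GE (k.+1 + size h)%N) ?leq_addl // big_split_ord /= [X in _ + X]big1 ?addr0.
  rewrite -he; apply: eq_bigr => i _; rewrite /G.
  by have ik := ltn_ord i; rewrite subzn.
move=> i _; rewrite /G; case E : (k%:Z - _) => [l|l]; last by rewrite mulr0.
by exfalso; move: E; lia.
Qed.

(** The set searched by [xget] is nonempty, so [CT] is the constant term of an actual expansion and
    not a default value. *)
Lemma CT_expansion (K : fieldType) (p g : {poly K}) : g != 0 ->
  exists2 c, laurent_expansion (tofrac p / tofrac g) c &
    CT (tofrac p / tofrac g) = c 0.
Proof.
move=> g0; have [c0 hc0] := laurent_expansion_exists p g0.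
rewrite /CT; set A := [set v | _].
have [c hc vc] : A (xget 0 A) by apply: (@xgetPex _ 0 A); exists (c0 0); exists c0.
by exists c.
Qed.

(** * Constant terms recovered from values along a sequence tending to 0 *)

Variables (K : numFieldType) (x : nat -> K).
Hypotheses (x_cvg0 : x m @[m --> \oo] --> (0 : K)) (x_neq0 : forall m, x m != 0).

Lemma near_horner_neq0 (g : {poly K}) : g != 0 -> \forall m \near \oo, g.[x m] != 0.
Proof.
move=> g0; have [a [h [-> h0]]] := poly_factor_Xn g0.
have : h.[x m] @[m --> \oo] --> h.[0] by apply: cvg_horner.
move=> /cvgr_neq0; rewrite horner_coef0 => /(_ h0); apply: filterS => m hm.
by rewrite hornerM hornerXn mulf_neq0 ?expf_neq0.
Qed.

(** The polynomial is $q^k$ times the expansion cut off after its constant term, so the difference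
    is minus the tail, which starts in degree at least 1. *)
Lemma laurent_expansion_cvg (p g : {poly K}) (c : int -> K) (k : nat) :
  g != 0 -> laurent_expansion (tofrac p / tofrac g) c ->
  (forall j, j < - k%:Z -> c j = 0) ->
  (\poly_(j < k.+1) c (j%:Z - k%:Z)).[x m] / x m ^+ k - p.[x m] / g.[x m]
    @[m --> \oo] --> (0 : K).
Proof.
move=> g0 [_ [p1 [g1 [g10 fE conv]]]] ck; set T := \poly_(j < _) _.
(* The fraction [p1 / g1] carried by the expansion may differ from [p / g]; only the cross products
   agree. *)
have {}fE : p * g1 = p1 * g.
  apply/eqP; rewrite -tofrac_eq !tofracM -(divr1 (_ * _)) -[X in _ == X]divr1; apply/eqP.
  move/eqP: fE; rewrite eqr_div ?tofrac_eq0 // => /eqP ->; by [].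
have [a [h [g1E h0]]] := poly_factor_Xn g10.
(* Since $q^a$ divides [g1], the coefficients of [g1 * T] below degree $k + 1 + a$ involve [T] only
   up to degree $k$, where it agrees with the shifted expansion. *)
have [Z TE] : exists Z, g1 * T - p1 * 'X^k = Z * 'X^(k.+1 + a).
  exists (drop_poly (k.+1 + a) (g1 * T - p1 * 'X^k)).
  rewrite -[LHS](poly_take_drop (k.+1 + a)) -[RHS]add0r; congr (_ + _).
  apply/polyP => j; rewrite coef_take_poly coef0; case: ifPn => // jk.
  rewrite coefB coefMXn coefM.
  have -> : (if (j < k)%N then 0 else p1`_(j - k)) =
      (if (j%:Z - k%:Z) is Posz l then p1`_l else 0).
    case: ltnP => jlk; last by rewrite subzn.
    by case E : (j%:Z - k%:Z) => [l|//]; exfalso; lia.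
  rewrite -conv; apply/eqP; rewrite subr_eq0; apply/eqP.
  (* The two convolution ranges differ, but [G] vanishes beyond [size g1] and, by the bound on the
     pole order, beyond [j]. *)
  pose G i := g1`_i * c (j%:Z - k%:Z - i%:Z).
  transitivity (\sum_(i < j.+1) G i).
    apply: eq_bigr => i _; rewrite /G g1E coefMXn; case: ltnP => ia; first by rewrite !mul0r.
    have ij := ltn_ord i; rewrite coef_poly ifT; last by lia.
    by congr (_ * c _); lia.
  have G1 i : (size g1 <= i)%N -> G i = 0 by move=> gi; rewrite /G nth_default ?mul0r.
  have G2 i : (j < i)%N -> G i = 0 by move=> gi; rewrite /G ck ?mulr0 //; lia.
  transitivity (\sum_(i < maxn j.+1 (size g1)) G i).
    rewrite (big_ord_widen _ G (leq_maxl _ (size g1))) big_mkcond /=.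
    by apply: eq_bigr => i _; case: ltnP => // /G2.
  rewrite [RHS](big_ord_widen _ G (leq_maxr j.+1 _)) [RHS]big_mkcond /=.
  by apply: eq_bigr => i _; case: ltnP => // /G1.
(* Dividing the remainder by $g_1(x) x^k$ leaves $x Z(x) / h(x)$. *)
have L : x m * Z.[x m] / h.[x m] @[m --> \oo] --> 0 * Z.[0] / h.[0].
  apply: cvgM; first by apply: cvgM => //; apply: cvg_horner.
  by apply: cvgV; [rewrite horner_coef0 | apply: cvg_horner].
rewrite !mul0r in L; apply: cvg_trans L; apply: near_eq_cvg.
have h_neq0 : h != 0 by apply: contraNneq h0 => ->; rewrite coef0.
near=> m.
have hm : h.[x m] != 0 by near: m; apply: near_horner_neq0.
have gm : g.[x m] != 0 by near: m; apply: near_horner_neq0.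
have g1m : g1.[x m] = h.[x m] * x m ^+ a by rewrite g1E hornerM hornerXn.
move: TE fE => /(congr1 (fun q => q.[x m])) + /(congr1 (fun q => q.[x m])).
rewrite !(hornerM, hornerD, hornerN, hornerXn) g1m exprD exprS => TE fE.
have xm := x_neq0 m.
have xk : x m ^+ k != 0 by rewrite expf_neq0.
have xa : x m ^+ a != 0 by rewrite expf_neq0.
have -> : p.[x m] / g.[x m] = p1.[x m] / (h.[x m] * x m ^+ a).
  by apply/eqP; rewrite eqr_div ?mulf_neq0 //; apply/eqP; rewrite fE.
have -> : T.[x m] / x m ^+ k - p1.[x m] / (h.[x m] * x m ^+ a) =
   (h.[x m] * x m ^+ a * T.[x m] - p1.[x m] * x m ^+ k) / (h.[x m] * x m ^+ a * x m ^+ k).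
  by field; rewrite xk hm xa.
by rewrite TE; field; rewrite xk hm xa.
Unshelve. all: by end_near. Qed.

(** A finite limit forces $T(0) = 0$ when the exponent is positive, so a factor $q$ can be stripped
    and the exponent lowered. *)
Lemma coef_of_cvg_horner_div (T : {poly K}) (k : nat) (v : K) :
  T.[x m] / x m ^+ k @[m --> \oo] --> v -> T`_k = v.
Proof.
elim: k T => [|k IHk] T Tv.
  move: Tv; under eq_fun do rewrite expr0 divr1; move=> Tv.
  rewrite -horner_coef0.
  by apply: (cvg_unique _ _ Tv) => //; apply: cvg_horner.
have T0 : root T 0.
  apply/eqP; apply: (@cvg_unique _ _ (T.[x m] @[m --> \oo])) => //.
    exact: cvg_horner.
  have -> : (fun m => T.[x m]) = (fun m => T.[x m] / x m ^+ k.+1 * x m ^+ k.+1).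
    by apply/funext => m; rewrite divfK // expf_neq0.
  have L : T.[x m] / x m ^+ k.+1 * x m ^+ k.+1 @[m --> \oo] --> v * 0 ^+ k.+1.
    by apply: cvgM => //; apply: cvg_exprn.
  by rewrite expr0n mulr0 in L.
have /factor_theorem [q TE] := T0; move: Tv; rewrite TE subr0 coefMX /= => Tv.
apply: IHk; apply: cvg_trans Tv.
have -> : (fun m => q.[x m] / x m ^+ k) = fun m => (q * 'X).[x m] / x m ^+ k.+1.
  by apply/funext => m; rewrite hornerM hornerX exprS invfM mulrA mulfK.
exact: cvg_id.
Qed.

(** The summands may diverge separately, so their truncated expansions are added over a common pole
    order [k0]. The sum stays within $o(1)$ of the given one, and its finite limit is the
    coefficient of degree [k0]. *)
Lemma sum_CT_of_cvg (I : finType) (P : pred I) (p g : I -> {poly K}) (v : K) :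
  (forall i, P i -> g i != 0) ->
  \sum_(i | P i) (p i).[x m] / (g i).[x m] @[m --> \oo] --> v ->
  \sum_(i | P i) CT (tofrac (p i) / tofrac (g i)) = v.
Proof.
move=> g0 fv.
have /choice [c hc] : forall i, exists c, P i ->
    laurent_expansion (tofrac (p i) / tofrac (g i)) c /\
    CT (tofrac (p i) / tofrac (g i)) = c 0.
  move=> i; case Pi : (P i); last by exists (fun=> 0).
  by have [c hc ctc] := CT_expansion (p i) (g0 i Pi); exists c.
have /choice [k hk] : forall i, exists k : nat, P i -> forall j, j < - k%:Z -> c i j = 0.
  move=> i; case Pi : (P i); last by exists 0%N.
  have [[k ck] _] := (hc i Pi).1.
  by exists `|k|%N => _ j jk; apply: ck; lia.
pose k0 := \max_i k i.
pose T i := \poly_(j < k0.+1) c i (j%:Z - k0%:Z).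
have Tk i : (T i)`_k0 = c i 0 by rewrite coef_poly ltnSn subrr.
transitivity (\sum_(i | P i) T i)`_k0.
  by rewrite coef_sum; apply: eq_bigr => i /hc [_ ->]; rewrite Tk.
apply: coef_of_cvg_horner_div; rewrite -[v]add0r.
rewrite -(_ : \sum_(i | P i) (0 : K) = 0); last exact: big1.
have -> : (fun m => (\sum_(i | P i) T i).[x m] / x m ^+ k0) = fun m =>
    \sum_(i | P i) ((T i).[x m] / x m ^+ k0 - (p i).[x m] / (g i).[x m]) +
    \sum_(i | P i) (p i).[x m] / (g i).[x m].
  by apply/funext => m; rewrite sumrB subrK horner_sum mulr_suml.
apply: cvgD => //; apply: cvg_bigsum => i Pi.
apply: laurent_expansion_cvg; [exact: g0|exact: (hc i Pi).1|].
move=> j jk; apply: hk => //; apply: lt_le_trans jk _.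
by rewrite lerN2 lez_nat; apply: leq_bigmax.
Qed.

End ConstantTerm.

(** * Abel's theorem with polynomial growth *)

Section Abel.
Variables (R : realType) (d : nat).

(** By Pascal's rule, multiplication by $1 - r$ lowers $k$ by one up to a boundary term; this drives
    the inductions on $k$ below. *)
Lemma sum_binomial_expr (r : R) (k n : nat) :
  (1 - r) * \sum_(0 <= s < n) 'C(s + k.+1, k.+1)%:R * r ^+ s =
  \sum_(0 <= s < n) 'C(s + k, k)%:R * r ^+ s - 'C(n + k, k.+1)%:R * r ^+ n.
Proof.
elim: n => [|n IHn]; first by rewrite !big_nil add0n bin_small // mulr0 mul0r subrr.
rewrite !big_nat_recr //= mulrDr IHn addnS addSn binS natrD exprS.
ring.
Qed.

Lemma sum_binomial_expr_le (r : R) (k n : nat) : 0 <= r < 1 ->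
  \sum_(0 <= s < n) 'C(s + k, k)%:R * r ^+ s <= (1 - r) ^- k.+1.
Proof.
move=> /andP[r0 r1]; have r1' : 0 < 1 - r by rewrite subr_gt0.
elim: k n => [|k IHk] n.
  rewrite expr1 -(ler_pM2l r1') mulfV ?gt_eqF //.
  rewrite (eq_bigr (fun s => r ^+ s)); last by move=> s _; rewrite addn0 bin0 mul1r.
  by rewrite big_mkord -sub1rX lerBlDr lerDl exprn_ge0.
rewrite -(ler_pM2l r1') sum_binomial_expr (exprS (1 - r) k.+1) invfM mulrA mulfV ?gt_eqF // mul1r.
by apply: le_trans (IHk n); rewrite lerBlDr lerDl mulr_ge0 ?exprn_ge0.
Qed.

Lemma nondecreasing_sum (f : nat -> R) : (forall s, 0 <= f s) ->
  nondecreasing_seq (fun n => \sum_(0 <= s < n) f s).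
Proof.
move=> f0; apply/nondecreasing_seqP => n.
by rewrite big_nat_recr //= lerDl.
Qed.

Lemma cvg_sum_of_bound (f : nat -> R) (M : R) : (forall s, 0 <= f s) ->
  (forall n, \sum_(0 <= s < n) f s <= M) ->
  cvgn (fun n => \sum_(0 <= s < n) f s).
Proof.
move=> f0 fM; apply: nondecreasing_is_cvgn; first exact: nondecreasing_sum.
by exists M => _ [n _ <-].
Qed.

Lemma cvg_binomial_series (r : R) (k : nat) : 0 <= r < 1 ->
  \sum_(0 <= s < n) 'C(s + k, k)%:R * r ^+ s @[n --> \oo] --> (1 - r) ^- k.+1.
Proof.
move=> r01; have /andP[r0 r1] := r01.
have r1' : 1 - r != 0 by rewrite subr_eq0 gt_eqF.
elim: k => [|k IHk].
  have -> : (fun n => \sum_(0 <= s < n) 'C(s + 0, 0)%:R * r ^+ s) =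
      fun n => (1 - r ^+ n) * (1 - r)^-1.
    apply/funext => n; rewrite sub1rX mulrAC mulfV // mul1r big_mkord.
    by apply: eq_bigr => i _; rewrite addn0 bin0 mul1r.
  have L : (1 - r ^+ n) * (1 - r)^-1 @[n --> \oo] --> (1 - 0) * (1 - r)^-1.
    apply: cvgMr_tmp; apply: cvgB; first exact: cvg_cst.
    by apply: cvg_expr; rewrite ger0_norm.
  by rewrite subr0 mul1r in L; rewrite expr1.
have f0 s : 0 <= 'C(s + k.+1, k.+1)%:R * r ^+ s by rewrite mulr_ge0 ?exprn_ge0.
(* This is the general term of a series with bounded partial sums; it dominates the boundary
   term. *)
have Z : 'C(n + k.+1, k.+1)%:R * r ^+ n @[n --> \oo] --> (0 : R).
  apply: (@cvg_series_cvg_0 _ R^o); apply: (cvg_sum_of_bound f0) => n.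
  exact: sum_binomial_expr_le.
have {}Z : 'C(n + k, k.+1)%:R * r ^+ n @[n --> \oo] --> (0 : R).
  apply: (squeeze_cvgr _ _ Z); last exact: cvg_cst.
  near=> n; rewrite mulr_ge0 ?exprn_ge0 //=; apply: ler_wpM2r; first exact: exprn_ge0.
  by rewrite ler_nat; apply: leq_bin2l; rewrite leq_add2l.
have -> : (fun n => \sum_(0 <= s < n) 'C(s + k.+1, k.+1)%:R * r ^+ s) =
    fun n => (1 - r)^-1 * (\sum_(0 <= s < n) 'C(s + k, k)%:R * r ^+ s -
                           'C(n + k, k.+1)%:R * r ^+ n).
  by apply/funext => n; rewrite -sum_binomial_expr mulrA mulVf // mul1r.
rewrite exprS invfM -[X in _ * X]subr0; apply: cvgMl_tmp.
exact: cvgB.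
Unshelve. all: by end_near. Qed.

Lemma cvg_natr_shift_ratio (j : nat) : (s%:R : R) / (s + j)%:R @[s --> \oo] --> (1 : R).
Proof.
have L : 1 - j%:R * (s + j.+1)%:R^-1 @[s --> \oo] --> (1 - j%:R * 0 : R).
  apply: cvgB; first exact: cvg_cst.
  apply: cvgMl_tmp.
  have := @cvg_harmonic R; rewrite -(cvg_shiftn j); apply: cvg_trans.
  by under eq_fun do rewrite addnS; exact: cvg_id.
rewrite -(cvg_shiftn 1).
have {}L : 1 - j%:R * (s.+1 + j)%:R^-1 @[s --> \oo] --> (1 : R).
  have -> : (fun s : nat => 1 - j%:R * (s.+1 + j)%:R^-1) =
    (fun s : nat => 1 - j%:R * (s + j.+1)%:R^-1 :> R) by apply/funext => s; rewrite addSnnS.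
  by rewrite mulr0 subr0 in L.
apply: cvg_trans L; apply: near_eq_cvg; near=> s => /=.
rewrite addn1 natrD.
have : (s.+1%:R + j%:R : R) != 0 by rewrite -natrD pnatr_eq0.
by move=> sj; field.
Unshelve. all: by end_near. Qed.

(** The product $d! \binom{s+d}{d}$ has $d$ factors, each asymptotic to $s$. Binomials thus replace
    $s^d$ as comparison coefficients, with a generating series in closed form. *)
Lemma cvg_expr_binomial_ratio :
  (s%:R : R) ^+ d / 'C(s + d, d)%:R @[s --> \oo] --> (d`!%:R : R).
Proof.
have L : d`!%:R * \prod_(i < d) ((s%:R : R) / (s + (d - i))%:R) @[s --> \oo] -->
    (d`!%:R * \prod_(i < d) 1 : R).
  by apply: cvgMl_tmp; apply: cvg_bigprod => i _; apply: cvg_natr_shift_ratio.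
rewrite big1 // mulr1 in L; apply: cvg_trans L; apply: near_eq_cvg; near=> s.
rewrite prodf_div prodr_const card_ord mulrCA; congr (_ * _).
have -> : \prod_(i < d) (s + (d - i))%:R = ('C(s + d, d) * d`!)%:R :> R.
  rewrite bin_ffact ffact_prod natr_prod; apply: eq_bigr => i _.
  by rewrite addnBA // ltnW.
rewrite natrM invfM mulrCA mulfV ?mulr1 // pnatr_eq0 -lt0n; exact: fact_gt0.
Unshelve. all: by end_near. Qed.

(** * Power series whose coefficients satisfy $a_s / s^d \to v$ *)

Variables (a : nat -> R) (v : R).
Hypotheses (a_ge0 : forall s, 0 <= a s)
  (a_cvg : s%:R ^- d * a s @[s --> \oo] --> v).

Let B r n : R := \sum_(0 <= s < n) 'C(s + d, d)%:R * r ^+ s.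
Let S r n : R := \sum_(0 <= s < n) a s * r ^+ s.

(** Beyond some [N] the coefficients differ from $d!\, v \binom{s+d}{d}$ by at most [eps] times the
    binomial. The finitely many earlier differences make up [M], uniformly in [r] and [n]. *)
Lemma power_sum_dist_binomial (eps : R) : 0 < eps ->
  exists2 M, 0 <= M & forall r n, 0 <= r < 1 ->
    `|S r n - d`!%:R * v * B r n| <= eps * B r n + M.
Proof.
move=> eps0; pose l := d`!%:R * v; pose b s : R := 'C(s + d, d)%:R.
have b_gt0 s : 0 < b s by rewrite /b ltr0n bin_gt0 leq_addl.
have : a s / b s @[s --> \oo] --> l.
  have L : (s%:R ^- d * a s) * ((s%:R : R) ^+ d / 'C(s + d, d)%:R) @[s --> \oo] --> v * d`!%:R.
    by apply: cvgM => //; exact: cvg_expr_binomial_ratio.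
  rewrite /l mulrC; apply: cvg_trans L; apply: near_eq_cvg; near=> s.
  have s0 : (s%:R : R) ^+ d != 0.
    rewrite expf_neq0 // pnatr_eq0 -lt0n; near: s; exact: nbhs_infty_gt.
  by rewrite mulrCA mulrA mulrA divff // mul1r mulrC.
move=> /cvgrPdist_le /(_ _ eps0) [N _ hN].
have dist s : `|a s - l * b s| <= eps * b s + (if (s < N)%N then `|a s - l * b s| else 0).
  case: ltnP => sN; first by rewrite lerDr mulr_ge0 // ltW.
  have := hN s sN; rewrite /= addr0 => le_eps.
  have -> : a s - l * b s = - (l - a s / b s) * b s.
    by rewrite opprB mulrBl divfK ?gt_eqF.
  by rewrite normrM normrN (gtr0_norm (b_gt0 s)) ler_wpM2r // ltW.
exists (\sum_(0 <= s < N) `|a s - l * b s|); first exact: sumr_ge0.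
move=> r n /andP[r0 r1]; rewrite /S /B mulr_sumr -sumrB.
apply: le_trans (ler_norm_sum _ _ _) _.
apply: (@le_trans _ _ (\sum_(0 <= s < n) (eps * (b s * r ^+ s) +
    (if (s < N)%N then `|a s - l * b s| else 0)))).
  apply: ler_sum => s _; rewrite (mulrA (_ * _)) -mulrBl normrM (ger0_norm (exprn_ge0 s r0)).
  apply: le_trans (ler_wpM2r (exprn_ge0 s r0) (dist s)) _.
  rewrite mulrDl mulrA lerD2l; case: ifP => _; last by rewrite mul0r.
  by rewrite ler_piMr // exprn_ile1 // ltW.
rewrite big_split /= -mulr_sumr lerD2l.
rewrite -big_mkcond /= !big_mkord.
have -> : \sum_(i < n | (i < N)%N) `|a i - l * b i| = \sum_(i < minn n N) `|a i - l * b i|.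
  rewrite (big_ord_widen_cond n (fun=> true) (fun i => `|a i - l * b i|) (geq_minl n N)) /=.
  by apply: eq_bigl => i; rewrite leq_min ltn_ord.
rewrite (big_ord_widen N (fun i => `|a i - l * b i|) (geq_minr n N)).
by rewrite [leRHS](bigID (fun i : 'I_N => (i < minn n N)%N)) /= lerDl sumr_ge0.
Unshelve. all: by end_near. Qed.

Lemma cvg_power_sum (r : R) : 0 <= r < 1 -> cvgn (fun n => S r n).
Proof.
move=> r01; have /andP[r0 r1] := r01.
have [M M0 hM] := power_sum_dist_binomial ltr01.
apply: (@cvg_sum_of_bound _ ((1 + `|d`!%:R * v|) * (1 - r) ^- d.+1 + M)).
  by move=> s; rewrite mulr_ge0 ?exprn_ge0.
move=> n; have := hM r n r01 => /ler_normlW; rewrite lerBlDr => /le_trans; apply.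
rewrite addrAC lerD2r mulrDl; apply: lerD.
  by rewrite !mul1r; apply: sum_binomial_expr_le.
have B0 : 0 <= B r n by apply: sumr_ge0 => s _; rewrite mulr_ge0 ?exprn_ge0.
apply: le_trans (ler_wpM2r B0 (ler_norm _)) _.
by apply: ler_wpM2l => //; apply: sum_binomial_expr_le.
Qed.

(** The comparison series sums to $(1-r)^{-(d+1)}$, so after scaling the main term is exactly $d!\,
    v$ and the error is at most $\varepsilon/2 + (1-r)^{d+1} M$. *)
Lemma abel_limit (r : nat -> R) : (forall j, 0 <= r j < 1) ->
  r j @[j --> \oo] --> (1 : R) ->
  (1 - r j) ^+ d.+1 * limn (fun n => S (r j) n) @[j --> \oo] --> (d`!%:R * v : R).
Proof.
move=> r01 r1; apply/cvgrPdist_le => eps eps0.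
have e2 : 0 < eps / 2 by rewrite divr_gt0.
have [M M0 hM] := power_sum_dist_binomial e2.
have Z : (1 - r j) ^+ d.+1 * M @[j --> \oo] --> ((1 - 1) ^+ d.+1 * M : R).
  by apply: cvgMr_tmp; apply: cvg_exprn; apply: cvgB => //; exact: cvg_cst.
rewrite subrr expr0n mul0r in Z.
move/cvgrPdist_le : Z => /(_ _ e2); apply: filterS => j.
have /andP[rj0 rj1] := r01 j.
have q0 : 0 < (1 - r j) ^+ d.+1 by rewrite exprn_gt0 // subr_gt0.
rewrite sub0r normrN ger0_norm ?(mulr_ge0 (ltW q0)) // => small.
have LS := cvg_power_sum (r01 j).
have LB := @cvg_binomial_series (r j) d (r01 j).
have dist : `|limn (fun n => S (r j) n) - d`!%:R * v * (1 - r j) ^- d.+1| <=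
    eps / 2 * (1 - r j) ^- d.+1 + M.
  have L1 : `|S (r j) n - d`!%:R * v * B (r j) n| @[n --> \oo] -->
     `|limn (fun n => S (r j) n) - d`!%:R * v * (1 - r j) ^- d.+1|.
    by apply: cvg_norm; apply: cvgB => //; apply: cvgMl_tmp.
  have L2 : eps / 2 * B (r j) n + M @[n --> \oo] --> eps / 2 * (1 - r j) ^- d.+1 + M.
    by apply: cvgD; [apply: cvgMl_tmp|exact: cvg_cst].
  by apply: (ler_cvg_to L1 L2); near=> n; apply: hM.
rewrite distrC.
have -> : (1 - r j) ^+ d.+1 * limn (fun n => S (r j) n) - d`!%:R * v =
   (1 - r j) ^+ d.+1 * (limn (fun n => S (r j) n) - d`!%:R * v * (1 - r j) ^- d.+1).
  by rewrite mulrBr; congr (_ - _); rewrite mulrCA mulfV ?mulr1 // gt_eqF.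
rewrite normrM gtr0_norm //; apply: le_trans (ler_wpM2l (ltW q0) dist) _.
rewrite mulrDr mulrCA mulfV ?gt_eqF // mulr1 [leRHS](splitr eps) lerD2l.
exact: small.
Unshelve. all: by end_near. Qed.

End Abel.

(** * Values of rational functions *)

Section RationalFunctionValues.

(** With [l] the order of [g] at 0, the coefficient of degree $i + l$ of $g h$ is $g_l h_i$ plus
    terms in the earlier coefficients of $h$. *)
Lemma coef_eq0_cancel (D : idomainType) (g : {poly D}) : g != 0 ->
  exists l, forall (h : {poly D}) m, (forall i, (i < m + l)%N -> (g * h)`_i = 0) ->
    forall i, (i < m)%N -> h`_i = 0.
Proof.
move=> g0.
have exg : exists l, g`_l != 0 by exists (size g).-1; rewrite -lead_coefE lead_coef_eq0.
case: (ex_minnP exg) => l gl lmin; exists l => h m gh0.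
elim/ltn_ind => i IHi im; have li : (l < (i + l).+1)%N by rewrite ltnS leq_addl.
have := gh0 (i + l)%N; rewrite ltn_add2r => /(_ im) /eqP.
rewrite coefM (bigD1 (Ordinal li)) //= big1 ?addr0; last first.
  move=> j jl; case: (ltngtP j l) => [lj|lj|lj].
  - rewrite (_ : g`_j = 0) ?mul0r //; apply/eqP; apply: contraTT lj => /lmin.
    by rewrite leqNgt.
  - by rewrite IHi ?mulr0 //; have := ltn_ord j; lia.
  - by case/eqP: jl; apply: val_inj.
by rewrite mulf_eq0 (negbTE gl) addnK /= => /eqP.
Qed.

(* Truncating the series beyond [s] by more than the order of [g] turns the
   cancellation of [g] into one of polynomials. *)
Lemma series_quotient_change (D : idomainType) (E : nat -> D)
    (p g p' g' : {poly D}) : g != 0 -> p * g' = p' * g ->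
  (forall s, \sum_(i < s.+1) g`_i * E (s - i)%N = p`_s) ->
  forall s, \sum_(i < s.+1) g'`_i * E (s - i)%N = p'`_s.
Proof.
move=> g0 pg' conv s.
pose T m : {poly D} := \poly_(i < m) E i.
have coefT (q : {poly D}) m i : (i < m)%N ->
    (q * T m)`_i = \sum_(j < i.+1) q`_j * E (i - j)%N.
  move=> im; rewrite coefM; apply: eq_bigr => j _.
  by rewrite coef_poly ifT //; lia.
have [l hl] := coef_eq0_cancel g0.
rewrite -(@coefT g' (s.+1 + l)%N) ?leq_addr //.
apply/eqP; rewrite -subr_eq0 -coefB; apply/eqP.
apply: (hl _ s.+1) => // i il.
(* By the cross product, $g (g' T - p') = g' (g T - p)$, and the low coefficients of $g T - p$
   vanish by [conv]. *)
rewrite mulrBr mulrCA (mulrC g p') -pg' (mulrC p) -mulrBr coefM big1 // => j _.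
rewrite coefB coefT ?conv ?subrr ?mulr0 //.
by apply: leq_ltn_trans il; rewrite leq_subr.
Qed.

(** * The localization at the kernel of an evaluation *)

Section LocalRing.
Variables (D : idomainType) (K : fieldType) (ev : {rmorphism D -> K}).

(* [f] lies in the localization of [D] at the kernel of [ev], and [ev] extended
   to this localization maps it to [z]. *)
Definition has_value (f : {fraction D}) (z : K) : Prop :=
  exists p g, [/\ ev g != 0, f = tofrac p / tofrac g & z = ev p / ev g].

Lemma tofrac_neq0_of_value p : ev p != 0 -> tofrac p != 0.
Proof. by rewrite tofrac_eq0; apply: contraNneq => ->; rewrite rmorph0. Qed.

Lemma has_value_tofrac p : has_value (tofrac p) (ev p).
Proof. by exists p, 1; rewrite tofrac1 rmorph1 oner_neq0 !divr1. Qed.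

Lemma has_value1 : has_value 1 1.
Proof. by have := has_value_tofrac 1; rewrite tofrac1 rmorph1. Qed.

Lemma has_value0 : has_value 0 0.
Proof. by have := has_value_tofrac 0; rewrite tofrac0 rmorph0. Qed.

Lemma has_valueD f1 f2 z1 z2 :
  has_value f1 z1 -> has_value f2 z2 -> has_value (f1 + f2) (z1 + z2).
Proof.
move=> [p1 [g1 [g10 -> ->]]] [p2 [g2 [g20 -> ->]]].
have [? ?] := (tofrac_neq0_of_value g10, tofrac_neq0_of_value g20).
exists (p1 * g2 + p2 * g1), (g1 * g2); split.
- by rewrite rmorphM mulf_neq0.
- by rewrite addf_div // tofracD !tofracM.
- by rewrite addf_div // rmorphD !rmorphM.
Qed.

Lemma has_valueM f1 f2 z1 z2 :
  has_value f1 z1 -> has_value f2 z2 -> has_value (f1 * f2) (z1 * z2).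
Proof.
move=> [p1 [g1 [g10 -> ->]]] [p2 [g2 [g20 -> ->]]].
exists (p1 * p2), (g1 * g2); split.
- by rewrite rmorphM mulf_neq0.
- by rewrite mulf_div !tofracM.
- by rewrite mulf_div !rmorphM.
Qed.

Lemma has_valueN f z : has_value f z -> has_value (- f) (- z).
Proof.
by move=> [p [g [g0 -> ->]]]; exists (- p), g; rewrite g0 tofracN rmorphN !mulNr.
Qed.

Lemma has_valueV f z : z != 0 -> has_value f z -> has_value f^-1 z^-1.
Proof.
move=> z0 [p [g [g0 -> zE]]]; exists g, p; split.
- by apply: contraNneq z0 => p0; rewrite zE p0 mul0r.
- by rewrite invf_div.
- by rewrite zE invf_div.
Qed.

Lemma has_value_exprz f z (m : int) : z != 0 -> has_value f z -> has_value (f ^ m) (z ^ m).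
Proof.
move=> z0 fz.
have nat_case k : has_value (f ^+ k) (z ^+ k).
  by elim: k => [|k IHk]; [exact: has_value1 | rewrite !exprS; apply: has_valueM].
case: m => k; first exact: nat_case.
by rewrite NegzE -!exprnN; apply: has_valueV; rewrite ?expf_neq0.
Qed.

Lemma has_value_sum (I : Type) (s : seq I) (f : I -> {fraction D}) (z : I -> K) :
  (forall i, has_value (f i) (z i)) ->
  has_value (\sum_(i <- s) f i) (\sum_(i <- s) z i).
Proof.
move=> fz; elim: s => [|i s IHs]; first by rewrite !big_nil; exact: has_value0.
by rewrite !big_cons; apply: has_valueD.
Qed.

Lemma has_value_prod (I : Type) (s : seq I) (f : I -> {fraction D}) (z : I -> K) :
  (forall i, has_value (f i) (z i)) ->
  has_value (\prod_(i <- s) f i) (\prod_(i <- s) z i).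
Proof.
move=> fz; elim: s => [|i s IHs]; first by rewrite !big_nil; exact: has_value1.
by rewrite !big_cons; apply: has_valueM.
Qed.

Lemma has_value_cross (p g : D) (z : K) : g != 0 ->
  has_value (tofrac p / tofrac g) z ->
  exists p' g', [/\ ev g' != 0, z = ev p' / ev g' & p * g' = p' * g].
Proof.
move=> g0 [p' [g' [g'0 fE ->]]]; exists p', g'; split => //.
have g'_neq0 := tofrac_neq0_of_value g'0.
have g_neq0 : tofrac g != 0 by rewrite tofrac_eq0.
apply/eqP; rewrite -tofrac_eq !tofracM.
by move/eqP: fE; rewrite (eqr_div _ _ g_neq0 g'_neq0).
Qed.

End LocalRing.

(** * Evaluation of the fractions and of the series at a point *)

Variables (K : fieldType) (n : nat) (y : 'I_n -> K) (t : K).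
Local Notation ratfun := {fraction {poly (mpoly n K)}}.

Definition poly_at : {poly (mpoly n K)} -> K := horner_eval t \o map_poly (meval y).

HB.instance Definition _ := GRing.RMorphism.on poly_at.

Local Notation ratfun_value := (has_value poly_at).

Lemma poly_atX : poly_at 'X = t.
Proof. by rewrite /poly_at /= map_polyX /horner_eval hornerX. Qed.

Lemma poly_atC c : poly_at c%:P = meval y c.
Proof. by rewrite /poly_at /= map_polyC /horner_eval hornerC. Qed.

Hypotheses (y_neq0 : forall j, y j != 0) (t_neq0 : t != 0).

Definition monom_at (nu : 'cV[int]_n) (m : int) : K := (\prod_(j < n) y j ^ nu j 0) * t ^ m.

Lemma has_value_lmonom nu m : ratfun_value (lmonom K nu m) (monom_at nu m).
Proof.
apply: has_valueM; last first.
  apply: has_value_exprz => //; rewrite -[t in ratfun_value _ t]poly_atX.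
  exact: has_value_tofrac.
apply: has_value_prod => j; apply: has_value_exprz => //.
rewrite -(mevalXU y) -poly_atC; exact: has_value_tofrac.
Qed.

Definition fterm_at (G : fterm K n) : K :=
  (\sum_(e <- finsupp (fnum G)) fnum G e * monom_at e.1 e.2) /
  \prod_(k < nfac G) (1 - monom_at (fnu k) (fexp k)).

Lemma has_value_fterm (G : fterm K n) :
  (forall k : 'I_(nfac G), monom_at (fnu k) (fexp k) != 1) ->
  ratfun_value (fterm_ratfun G) (fterm_at G).
Proof.
move=> G1; apply: has_valueM.
  apply: has_value_sum => e; apply: has_valueM; last exact: has_value_lmonom.
  rewrite -[X in ratfun_value _ X](mevalC y) -poly_atC; exact: has_value_tofrac.
apply: has_valueV; first by apply/prodf_neq0 => k _; rewrite subr_eq0 eq_sym.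
apply: has_value_prod => k; apply: has_valueD; first exact: has_value1.
by apply: has_valueN; exact: has_value_lmonom.
Qed.

(** The denominator supplied by the series identity may vanish at the point. It is exchanged for one
    that does not, and then only the coefficients are evaluated at [y], keeping a power series
    identity in one variable. *)
Lemma series_eq_ratfun_at (E : nat -> mpoly n K) (f : ratfun) (z : K) :
  series_eq_ratfun E f -> ratfun_value f z ->
  exists p g : {poly K}, [/\ g.[t] != 0, z = p.[t] / g.[t]
    & forall s, \sum_(i < s.+1) g`_i * meval y (E (s - i)%N) = p`_s].
Proof.
move=> [p [g [g0 -> conv]]] /(has_value_cross g0) [p' [g' [g'0 -> pg']]].
exists (map_poly (meval y) p'), (map_poly (meval y) g'); split => // s.
rewrite coef_map /= -(series_quotient_change g0 pg' conv) raddf_sum /=.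
by apply: eq_bigr => i _; rewrite mevalM coef_map.
Qed.

Lemma series_eq_sum_fterm_at (E : nat -> mpoly n K) (N : nat) (F : 'I_N -> fterm K n) :
  series_eq_ratfun E (\sum_(i < N) fterm_ratfun (F i)) ->
  (forall i (k : 'I_(nfac (F i))), monom_at (fnu k) (fexp k) != 1) ->
  exists p g : {poly K}, [/\ g.[t] != 0, \sum_(i < N) fterm_at (F i) = p.[t] / g.[t]
    & forall s, \sum_(i < s.+1) g`_i * meval y (E (s - i)%N) = p`_s].
Proof.
move=> EF F1; apply: (series_eq_ratfun_at EF).
by apply: has_value_sum => i; apply: has_value_fterm.
Qed.

End RationalFunctionValues.

(** * The curve attached to beta *)

Section CurveLimit.
Variables (K : numFieldType) (n : nat) (beta : 'cV[int]_n).

Definition beta_point (u : K) (j : 'I_n) : K := u ^ (- beta j 0).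

(* The exponent of [u] in [y ^ nu * t ^ m] along the curve
   [y_j = u ^ (- beta_j)], [t = u ^ M]. *)
Definition beta_exponent (M : nat) (nu : 'cV[int]_n) (m : int) : int :=
  m * M%:Z - pairing beta nu.

Lemma monom_at_beta (u : K) (M : nat) nu m : u != 0 ->
  monom_at (beta_point u) (u ^+ M) nu m = u ^ beta_exponent M nu m.
Proof.
move=> u0; rewrite /monom_at /beta_exponent expfzDr // mulrC; congr (_ * _).
  by rewrite exprnP exprz_exp mulrC.
rewrite /pairing mxE (big_morph (fun z => u ^ (- z)) (id1 := 1) (op1 := *%R)); last 2 first.
- by move=> a b /=; rewrite opprD expfzDr.
- by rewrite oppr0 expr0z.
by apply: eq_bigr => j _; rewrite mxE /beta_point exprz_exp mulNr.
Qed.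

(** Each denominator factor has a simple zero at $u = 1$ and absorbs one factor $1 - u$; a surplus
    factor sends the product to 0. *)
Lemma cvg_fterm_at_beta (u : nat -> K) (d M : nat) (G : fterm K n) :
  u j @[j --> \oo] --> (1 : K) -> (forall j, u j != 0) -> (forall j, u j != 1) ->
  (nfac G <= d.+1)%N ->
  (forall k : 'I_(nfac G), beta_exponent M (fnu k) (fexp k) != 0) ->
  (1 - u j) ^+ d.+1 * fterm_at (beta_point (u j)) (u j ^+ M) G @[j --> \oo] -->
    (if nfac G == d.+1 then laurent_at1 (fnum G) /
       \prod_(k < nfac G) (beta_exponent M (fnu k) (fexp k))%:~R else 0 : K).
Proof.
move=> u1 un0 un1 Gd e0; pose e (k : 'I_(nfac G)) := beta_exponent M (fnu k) (fexp k).
have L : (1 - u j) ^+ (d.+1 - nfac G) *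
   ((\sum_(x <- finsupp (fnum G)) fnum G x * u j ^ beta_exponent M x.1 x.2) /
    \prod_(k < nfac G) ((1 - u j ^ e k) / (1 - u j))) @[j --> \oo] -->
  (1 - 1) ^+ (d.+1 - nfac G) *
   ((\sum_(x <- finsupp (fnum G)) fnum G x * 1 ^ beta_exponent M x.1 x.2) /
    \prod_(k < nfac G) (e k)%:~R).
  apply: cvgM; first by apply: cvg_exprn; apply: cvgB => //; exact: cvg_cst.
  apply: cvgM.
    apply: cvg_bigsum => x _; apply: cvgMl_tmp.
    by apply: cvg_exprz => //; exact: oner_neq0.
  apply: cvgV; first by apply/prodf_neq0 => k _; rewrite intr_eq0 e0.
  by apply: cvg_bigprod => k _; apply: cvg_subr1_exprz_ratio.
(* The power $0^{d+1-h}$, with $h$ the number of factors, is 1 exactly when $h = d + 1$. *)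
move: L; rewrite subrr expr0n subn_eq0.
have -> : (d.+1 <= nfac G)%N = (nfac G == d.+1) by rewrite eqn_leq Gd.
have -> : (\sum_(x <- finsupp (fnum G)) fnum G x * 1 ^ beta_exponent M x.1 x.2) =
    laurent_at1 (fnum G) by rewrite /laurent_at1; apply: eq_bigr => x _; rewrite exp1rz mulr1.
move=> L; have {L} : (1 - u j) ^+ (d.+1 - nfac G) *
   ((\sum_(x <- finsupp (fnum G)) fnum G x * u j ^ beta_exponent M x.1 x.2) /
    \prod_(k < nfac G) ((1 - u j ^ e k) / (1 - u j))) @[j --> \oo] -->
  (if nfac G == d.+1 then laurent_at1 (fnum G) / \prod_(k < nfac G) (e k)%:~R else 0).
  by case: eqP L => _; rewrite ?mul1r ?mul0r.
apply: cvg_trans; apply: near_eq_cvg; near=> j => /=.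
have uj : 1 - u j != 0 by rewrite subr_eq0 eq_sym.
rewrite prodf_div prodr_const card_ord invf_div mulrCA mulrA.
rewrite [X in _ = X]mulrC -[d.+1 in RHS](subnK Gd) exprD /fterm_at.
rewrite -!mulrA; congr (_ * _).
  by apply: eq_bigr => x _; rewrite monom_at_beta.
rewrite mulrC mulrA; congr (_ * _); congr (_^-1).
by apply: eq_bigr => k _; rewrite monom_at_beta.
Unshelve. all: by end_near. Qed.

End CurveLimit.

(** * Lattice points of dilated polytopes *)

Section LatticePoints.
Variables (R : realType) (r n : nat) (A : 'M[int]_(r, n)) (b : 'cV[int]_r).
Variable beta : 'cV[int]_n.

Local Notation P := (polytope R A b).
Local Notation points s :=
  (fset_set [set a : multinom n | dilate s P (\col_(j < n) (a j)%:R)]).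

(** Points of the polytope have nonnegative coordinates, so its integer points are exponent
    vectors. *)
Lemma lattice_count_polytope (s : nat) : lattice_count (dilate s P) = #|` points s|.
Proof.
pose f (a : multinom n) : 'cV[int]_n := \col_j (a j)%:Z.
have f_inj : injective f.
  by move=> a a' faa'; apply/mnmP => j; have /matrixP/(_ j 0) := faa'; rewrite !mxE => -[].
set X := [set a : multinom n | _].
have fE a : map_mx intr (f a) = \col_(j < n) (a j)%:R :> 'cV[R]_n.
  by apply/matrixP => i j; rewrite !mxE.
have -> : lattice_count (dilate s P) = #|` fset_set (f @` X)|.
  congr #|` fset_set _|; apply/seteqP; split => [z /= Pz|_ [a Xa <-]] /=; last by rewrite fE.
  have z0 j : 0 <= z j 0.
    case: Pz => x [x0 _] /matrixP/(_ j 0); rewrite !mxE => zx.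
    by rewrite -(ler0z R) -zx mulr_ge0.
  pose a := Multinom [tuple absz (z j 0) | j < n].
  have zE : f a = z.
    by apply/matrixP => j k; rewrite mxE mnmE (ord1 k) gez0_abs.
  by exists a => //; rewrite /X /= -fE zE.
have [Xfin|Xinf] := pselect (finite_set X).
  by rewrite fset_set_image // card_imfset.
(* For an infinite set both sides are 0, since [fset_set] is then empty. *)
have fXinf : ~ finite_set (f @` X).
  move=> fX; apply: Xinf; apply: sub_finite_set (finite_preimage _ fX).
    by move=> a Xa; exists a.
  by move=> a a' _ _; exact: f_inj.
by rewrite /fset_set; case: pselect => // _; case: pselect.
Qed.

Lemma pairing_dilate_bound : bounded_set P ->
  exists C : nat, forall s (a : multinom n), a \in points s ->
    `|\sum_(j < n) beta j 0 * (a j)%:Z| <= (C * s)%:Z.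
Proof.
move=> [B [_ hB]].
(* Boundedness only speaks of bounds strictly above [B], which may be negative; [|B| + 1] is one. *)
have {}hB x j : P x -> `|x j 0| <= `|B| + 1.
  move=> /hB => /(_ (`|B| + 1)).
  have -> : (B < `|B| + 1) by rewrite (le_lt_trans (ler_norm B)) // ltrDl.
  move=> /(_ isT); apply: le_trans.
  rewrite [leRHS]mx_normrE.
  by apply: (le_bigmax _ (fun ij : 'I_n * 'I_1 => `|x ij.1 ij.2|) (j, 0)).
pose D : R := \sum_(j < n) `|(beta j 0)%:~R| * (`|B| + 1).
have D0 : 0 <= D by apply: sumr_ge0 => j _; rewrite mulr_ge0 // addr_ge0.
exists (Num.bound D) => s a.
set X := [set a : multinom n | _].
have [Xfin|Xinf] := pselect (finite_set X); last by rewrite /fset_set; case: pselect.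
rewrite in_fset_set // inE => -[x Px /matrixP xa].
rewrite -(ler_int R) intr_norm rmorph_sum /=.
apply: le_trans (ler_norm_sum _ _ _) _.
apply: (@le_trans _ _ (D * s%:R)); last first.
  rewrite PoszM intrM; apply: ler_wpM2r => //.
  exact: ltW (archi_boundP D0).
rewrite mulr_suml; apply: ler_sum => j _; rewrite rmorphM normrM /= -mulrA.
apply: ler_wpM2l => //; have := xa j 0; rewrite !mxE => xaj.
by rewrite -pmulrn -xaj normrM normr_nat mulrC ler_wpM2r // hB.
Qed.

(** The coefficient of $t^s$ in the Ehrhart series on the curve, kept real so that it can be
    compared with lattice counts. *)
Definition beta_sum (u : R) (s : nat) : R :=
  \sum_(a <- points s) u ^ (- \sum_(j < n) beta j 0 * (a j)%:Z).

Lemma meval_ehrhart_series (u : R) (s : nat) : u != 0 ->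
  meval (beta_point beta (u%:C%C : (R[i] : numFieldType))) (ehrhart_series R[i] P s) =
  (beta_sum u s)%:C%C.
Proof.
move=> u0; rewrite /ehrhart_series raddf_sum /beta_sum rmorph_sum /=.
apply: eq_bigr => a _; rewrite mevalX fmorphXz /=.
rewrite (big_morph (fun z => (u%:C%C : R[i]) ^ (- z)) (id1 := 1) (op1 := *%R)); last 2 first.
- by move=> x y /=; rewrite opprD expfzDr // fmorph_eq0.
- by rewrite oppr0 expr0z.
by apply: eq_bigr => j _; rewrite /beta_point exprnP exprz_exp mulNr.
Qed.

Lemma exprz_bounds (u : R) (z : int) (k : nat) : 0 < u < 1 -> `|z| <= k%:Z ->
  u ^+ k <= u ^ z <= u ^- k.
Proof.
move=> /andP[u0 u1] zk.
have le1 m : u ^+ m <= 1 by rewrite exprn_ile1 // ltW.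
have nat_case m : (m <= k)%N -> u ^+ k <= u ^+ m.
  by move=> mk; apply: ler_wiXn2l => //; exact: ltW.
have ge1 m : 1 <= u ^- m by rewrite invf_ge1 ?exprn_gt0.
case: z zk => m mk; first by rewrite nat_case //= (le_trans (le1 m)).
rewrite NegzE -exprnN (le_trans (le1 k)) //=.
by rewrite lef_pV2 ?posrE ?exprn_gt0 // nat_case.
Qed.

Lemma beta_sum_bounds (C : nat) :
  (forall s (a : multinom n), a \in points s ->
    `|\sum_(j < n) beta j 0 * (a j)%:Z| <= (C * s)%:Z) ->
  forall (u : R) (s : nat), 0 < u < 1 ->
  (lattice_count (dilate s P))%:R * u ^+ (C * s) <= beta_sum u s <=
  (lattice_count (dilate s P))%:R * u ^- (C * s).
Proof.
move=> hC u s u01.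
have cE (c : R) : (lattice_count (dilate s P))%:R * c = \sum_(a <- points s) c.
  by rewrite lattice_count_polytope big_const_seq count_predT iter_addr_0 mulr_natl.
rewrite !cE; apply/andP; split; rewrite /beta_sum big_seq [leRHS]big_seq;
  by apply: ler_sum => a /hC aC; have /andP[] := @exprz_bounds u
       (- \sum_(j < n) beta j 0 * (a j)%:Z) _ u01 (eq_ind_r (fun x => x <= _) aC (normrN _)).
Qed.

End LatticePoints.

(** * The Ehrhart series along the curve *)

Section EhrhartAlongCurve.
Variables (R : realType) (r n d N : nat) (A : 'M[int]_(r, n)) (b : 'cV[int]_r).
Variables (F : 'I_N -> fterm R[i] n) (beta : 'cV[int]_n) (v : R) (C : nat).
Local Notation P := (polytope R A b).
Local Notation K := (R[i] : numFieldType).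

Hypothesis density_cvg : lattice_density d P s @[s --> \oo] --> v.
Hypothesis F_nfac : forall i, (nfac (F i) <= d.+1)%N.
Hypothesis F_sum : series_eq_ratfun (ehrhart_series R[i] P)
  (\sum_(i < N) fterm_ratfun (F i)).
Hypothesis beta_sum_bound : forall (u : R) (s : nat), 0 < u < 1 ->
  (lattice_count (dilate s P))%:R * u ^+ (C * s) <= beta_sum A b beta u s <=
  (lattice_count (dilate s P))%:R * u ^- (C * s).

Let a s : R := (lattice_count (dilate s P))%:R.
Let a_ge0 s : 0 <= a s. Proof. exact: ler0n. Qed.
Let S (x : R) m : R := \sum_(0 <= s < m) a s * x ^+ s.
Let W (M : nat) (u : R) m : R := \sum_(0 <= s < m) beta_sum A b beta u s * (u ^+ M) ^+ s.

Variable M : nat.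
Hypothesis C_lt_M : (C < M)%N.
Hypothesis exponent_neq0 : forall i (k : 'I_(nfac (F i))),
  beta_exponent beta M (fnu k) (fexp k) != 0.

Let expr_01 (u : R) k : 0 < u < 1 -> (0 < k)%N -> 0 <= u ^+ k < 1.
Proof.
by move=> /andP[u0 u1] k0; rewrite exprn_ge0 ?ltW //= exprn_ilt1 // -?lt0n // ltW.
Qed.

Lemma beta_term_bounds (u : R) s : 0 < u < 1 ->
  a s * (u ^+ (M + C)) ^+ s <= beta_sum A b beta u s * (u ^+ M) ^+ s <=
  a s * (u ^+ (M - C)) ^+ s.
Proof.
move=> u01; have /andP[u0 u1] := u01; have /andP[lo hi] := @beta_sum_bound u s u01.
have uM : 0 <= (u ^+ M) ^+ s by rewrite !exprn_ge0 // ltW.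
apply/andP; split.
  have -> : (u ^+ (M + C)) ^+ s = u ^+ (C * s) * (u ^+ M) ^+ s.
    by rewrite -!exprM -exprD addnC mulnDl.
  by rewrite mulrA ler_wpM2r.
apply: le_trans (ler_wpM2r uM hi) _.
rewrite -mulrA ler_wpM2l // -!exprM mulnBl.
have -> : u ^+ (M * s) = u ^+ (C * s) * u ^+ (M * s - C * s).
  by rewrite -exprD subnKC // leq_mul2r ltnW ?orbT.
by rewrite mulrA mulVf ?mul1r // expf_neq0 // gt_eqF.
Qed.

(** As $C < M$, the dominating series is taken at $u^{M-C} < 1$, where polynomial growth of the
    counts gives convergence. *)
Lemma cvg_beta_series (u : R) : 0 < u < 1 -> cvgn (W M u).
Proof.
move=> u01; have /andP[u0 u1] := u01.
have u'01 : 0 <= u ^+ (M - C) < 1 by apply: expr_01; rewrite ?subn_gt0.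
apply: (@cvg_sum_of_bound _ _ (limn (S (u ^+ (M - C))))).
  move=> s; have /andP[lo _] := beta_term_bounds s u01; apply: le_trans lo.
  by rewrite mulr_ge0 // !exprn_ge0 // ltW.
move=> m; apply: (@le_trans _ _ (S (u ^+ (M - C)) m)).
  by apply: ler_sum => s _; have /andP[] := beta_term_bounds s u01.
apply: nondecreasing_cvgn_le; last exact: cvg_power_sum density_cvg _ u'01.
by apply: nondecreasing_sum => s; rewrite mulr_ge0 // !exprn_ge0 // ltW.
Qed.

Lemma beta_series_bounds (u : R) : 0 < u < 1 ->
  limn (S (u ^+ (M + C))) <= limn (W M u) <= limn (S (u ^+ (M - C))).
Proof.
move=> u01; have Wc := cvg_beta_series u01.
have M0 : (0 < M)%N by apply: leq_ltn_trans C_lt_M.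
have Sc1 : cvgn (S (u ^+ (M + C))).
  by apply: cvg_power_sum density_cvg _ _ => //; apply: expr_01; rewrite ?addn_gt0 ?M0.
have Sc2 : cvgn (S (u ^+ (M - C))).
  by apply: cvg_power_sum density_cvg _ _ => //; apply: expr_01; rewrite ?subn_gt0.
apply/andP; split; apply: ler_lim => //; near=> m; apply: ler_sum => s _;
  by have /andP[] := beta_term_bounds s u01.
Unshelve. all: by end_near. Qed.

(** For $0 < u < 1$ a nonzero exponent gives $u^e \ne 1$, so every fraction is regular at the point
    of the curve and the series identity can be evaluated there. *)
Lemma beta_series_value (u : R) : 0 < u < 1 ->
  (limn (W M u))%:C%C =
  \sum_(i < N) fterm_at (beta_point beta (u%:C%C : K)) ((u%:C%C : K) ^+ M) (F i).
Proof.
move=> u01; have /andP[u0 u1] := u01.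
have uC0 : (u%:C%C : K) != 0 by rewrite fmorph_eq0 gt_eqF.
set y := beta_point _ _; set t := _ ^+ M.
have expr_neq1 k : (0 < k)%N -> (u%:C%C : K) ^+ k != 1.
  move=> k0; rewrite -rmorphXn -(rmorph1 (real_complex R)).
  rewrite (inj_eq (fmorph_inj _)) lt_eqF //.
  by have /andP[] := @expr_01 u k u01 k0.
have expz_neq1 (e : int) : e != 0 -> (u%:C%C : K) ^ e != 1.
  case: e => k k0; first by apply: expr_neq1; rewrite lt0n.
  by rewrite NegzE -exprnN invr_eq1 expr_neq1.
have [||i k|p [g [g0 -> conv]]] := series_eq_sum_fterm_at (y := y) (t := t) _ _ F_sum.
- by move=> j; rewrite /y /beta_point expfz_neq0.
- by rewrite expf_neq0.
- by rewrite monom_at_beta // expz_neq1.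
apply/eqP; rewrite eq_sym -(inj_eq (mulfI g0)) mulrCA mulfV // mulr1; apply/eqP/esym.
have yE s : meval y (ehrhart_series R[i] P s) = (beta_sum A b beta u s)%:C%C.
  by apply: meval_ehrhart_series; rewrite gt_eqF.
have {}conv s : \sum_(i < s.+1) g`_i * (beta_sum A b beta u (s - i))%:C%C = p`_s.
  by rewrite -conv; apply: eq_bigr => i _; congr (_ * _); exact/esym/yE.
apply: (cvg_series_mul_poly (e := fun s => (beta_sum A b beta u s)%:C%C : K) conv).
have := cvg_real_complex (cvg_beta_series u01); apply: cvg_trans.
apply: near_eq_cvg; near=> m; rewrite rmorph_sum /=; apply: eq_bigr => s _.
by rewrite rmorphM rmorphXn /= rmorphXn.
Unshelve. all: by end_near. Qed.

(** The shift by 2 keeps the first term, $1/2$, strictly positive. *)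
Let u (j : nat) : R := 1 - j.+2%:R^-1.

Let u01 j : 0 < u j < 1.
Proof.
rewrite /u subr_gt0 invf_lt1 ?ltr0n // ltr1n /=.
by rewrite ltrBlDr ltrDl invr_gt0 ltr0n.
Qed.

Let u_cvg1 : u j @[j --> \oo] --> (1 : R).
Proof.
suff L : u j @[j --> \oo] --> (1 - 0 : R) by rewrite subr0 in L.
apply: cvgB; first exact: cvg_cst.
have := @cvg_harmonic R; rewrite -(cvg_shiftn 1); apply: cvg_trans.
by apply: near_eq_cvg; near=> j; rewrite /= addn1.
Unshelve. all: by end_near. Qed.

(** Abel's limit at $r = u^k$ is normalized by $(1 - u^k)^{d+1}$; the ratio $(1 - u^k)/(1 - u) \to
    k$ changes the normalization. *)
Lemma cvg_abel_pow (k : nat) : (0 < k)%N ->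
  (1 - u j) ^+ d.+1 * limn (S (u j ^+ k)) @[j --> \oo] --> (d`!%:R * v / k%:R ^+ d.+1 : R).
Proof.
move=> k0.
have [un0 un1] : (forall j, u j != 0) /\ (forall j, u j != 1).
  by split=> j; have /andP[u0 u1] := u01 j; [rewrite gt_eqF | rewrite lt_eqF].
have L1 : (1 - u j ^+ k) ^+ d.+1 * limn (S (u j ^+ k)) @[j --> \oo] --> d`!%:R * v.
  apply: (abel_limit a_ge0 density_cvg) => [j|]; first exact: expr_01.
  suff L : u j ^+ k @[j --> \oo] --> (1 ^+ k : R) by rewrite expr1n in L.
  exact: cvg_exprn.
have L2 : (((1 - u j ^+ k) / (1 - u j)) ^+ d.+1)^-1 @[j --> \oo] --> (k%:R ^+ d.+1 : R)^-1.
  apply: cvgV; first by rewrite expf_neq0 // pnatr_eq0 -lt0n.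
  apply: cvg_exprn; exact: (@cvg_subr1_exprz_ratio _ _ _ _ u k%:Z).
apply: cvg_trans (cvgM L1 L2); apply: near_eq_cvg; near=> j => /=.
have q1 : (1 - u j) ^+ d.+1 != 0 by rewrite expf_neq0 // subr_eq0 eq_sym.
have q2 : (1 - u j ^+ k) ^+ d.+1 != 0.
  rewrite expf_neq0 // subr_eq0 eq_sym lt_eqF //.
  by have /andP[] := expr_01 (u01 j) k0.
by rewrite expr_div_n invf_div mulrC mulrA divfK.
Unshelve. all: by end_near. Qed.

(** The complex sum is the limit of the real numbers [w j], hence real, and the squeeze of the
    series passes to the limit. *)
Lemma sum_residues_bounds : exists2 h : R,
  \sum_(i < N) (if nfac (F i) == d.+1 then laurent_at1 (fnum (F i)) /
     \prod_(k < nfac (F i)) (beta_exponent beta M (fnu k) (fexp k))%:~R else 0) = h%:C%C &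
  d`!%:R * v / (M + C)%:R ^+ d.+1 <= h <= d`!%:R * v / (M - C)%:R ^+ d.+1.
Proof.
set H := \sum_(i < N) _.
pose w j := (1 - u j) ^+ d.+1 * limn (W M (u j)).
have wH : ((w j)%:C%C : K) @[j --> \oo] --> (H : K).
  have L : \sum_(i < N) (1 - ((u j)%:C%C : K)) ^+ d.+1 *
      fterm_at (beta_point beta ((u j)%:C%C : K)) (((u j)%:C%C : K) ^+ M) (F i)
      @[j --> \oo] --> (H : K).
    apply: cvg_bigsum => i _; apply: cvg_fterm_at_beta => //.
    - by have := cvg_real_complex u_cvg1; rewrite rmorph1.
    - by move=> j; rewrite fmorph_eq0; have /andP[? _] := u01 j; rewrite gt_eqF.
    - move=> j; rewrite -(rmorph1 (real_complex R)) (inj_eq (fmorph_inj _)).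
      by have /andP[_ ?] := u01 j; rewrite lt_eqF.
  apply: cvg_trans L; apply: near_eq_cvg; near=> j => /=.
  rewrite -mulr_sumr -beta_series_value // [RHS](rmorphM (real_complex R)).
  by rewrite (rmorphXn (real_complex R)) (rmorphB (real_complex R) 1 (u j)) rmorph1.
have [wR HE] := cvg_complex_real wH; exists (complex.Re H) => //.
have M0 : (0 < M)%N by apply: leq_ltn_trans C_lt_M.
have q0 j : 0 <= (1 - u j) ^+ d.+1.
  by rewrite exprn_ge0 // subr_ge0; have /andP[_ /ltW] := u01 j.
have MC1 : (0 < M + C)%N by rewrite addn_gt0 M0.
have MC2 : (0 < M - C)%N by rewrite subn_gt0.
apply/andP; split.
  apply: (ler_cvg_to (cvg_abel_pow MC1) wR); near=> j.
  by rewrite ler_wpM2l //; have /andP[] := beta_series_bounds (u01 j).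
apply: (ler_cvg_to wR (cvg_abel_pow MC2)); near=> j.
by rewrite ler_wpM2l //; have /andP[] := beta_series_bounds (u01 j).
Unshelve. all: by end_near. Qed.

End EhrhartAlongCurve.

(** * Constant term and volume *)

(** If $m \ne 0$, then $|m M| \ge M$ exceeds the pairing; if $m = 0$, the pairing itself is
    nonzero. *)
Lemma beta_exponent_neq0 (n : nat) (beta nu : 'cV[int]_n) (m : int) (M : nat) :
  ~ (pairing beta nu = 0 /\ m = 0) -> (`|pairing beta nu| < M)%N ->
  beta_exponent beta M nu m != 0.
Proof.
rewrite /beta_exponent; set c := pairing beta nu => cm cM; apply/eqP => e0.
have [m0|m0] := eqVneq m 0; first by apply: cm; split => //; move: e0; rewrite m0; lia.
have : (M <= absz (m * M%:Z)%R)%N by rewrite abszM absz_nat leq_pmull // absz_gt0.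
by move: e0 => /eqP; rewrite subr_eq0 => /eqP ->; rewrite leqNgt cM.
Qed.

(** The substitution $q = 1/M$ turns the denominators of the algebraic volume into the exponents on
    the curve, up to the factor $M$. *)
Lemma horner_beta_factor (K : numFieldType) (n : nat) (beta nu : 'cV[int]_n)
    (m : int) (M : nat) : (0 < M)%N ->
  ((m%:~R)%:P - (pairing beta nu)%:~R *: 'X : {poly K}).[M%:R^-1] =
  (beta_exponent beta M nu m)%:~R / M%:R.
Proof.
move=> M0; have MK : (M%:R : K) != 0 by rewrite pnatr_eq0 -lt0n.
rewrite hornerD hornerN hornerZ hornerC hornerX /beta_exponent rmorphB rmorphM /=.
by rewrite -pmulrn mulrBl mulfK.
Qed.

Lemma beta_factor_neq0 (K : numFieldType) (c m : int) : ~ (c = 0 /\ m = 0) ->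
  ((m%:~R)%:P - c%:~R *: 'X : {poly K}) != 0.
Proof.
move=> cm; apply/eqP => f0; apply: cm; split; apply/eqP; rewrite -(intr_eq0 K).
  have := congr1 (fun q : {poly K} => q`_1) f0.
  by rewrite !coefE /= mulr1 sub0r => /eqP; rewrite oppr_eq0.
have := congr1 (fun q : {poly K} => q`_0) f0.
by rewrite !coefE /= mulr0 subr0 => /eqP.
Qed.

Lemma cvg_scaled_squeeze (R : realType) (d C : nat) (l : R) (h : nat -> R) :
  (forall m, l / (m + C.+1 + C)%:R ^+ d <= h m <= l / (m + C.+1 - C)%:R ^+ d) ->
  (m + C.+1)%:R ^+ d * h m @[m --> \oo] --> l.
Proof.
move=> hb.
have L1 : l * ((m + C.+1)%:R / (m + C.+1 + C)%:R) ^+ d @[m --> \oo] --> (l * 1 ^+ d : R).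
  apply: cvgMl_tmp; apply: cvg_exprn.
  by have := @cvg_natr_shift_ratio R C; rewrite -(cvg_shiftn C.+1).
(* With $M = m + C + 1$ one has $M - C = m + 1$, so this ratio is the inverse of one tending to
   1. *)
have L2 : l * ((m.+1%:R / (m.+1 + C)%:R) ^+ d)^-1 @[m --> \oo] --> (l * (1 ^+ d)^-1 : R).
  apply: cvgMl_tmp; apply: cvgV; first by rewrite expf_neq0 ?oner_neq0.
  apply: cvg_exprn.
  have := @cvg_natr_shift_ratio R C; rewrite -(cvg_shiftn 1); apply: cvg_trans.
  by apply: near_eq_cvg; near=> m; rewrite /= addn1.
rewrite !expr1n invr1 mulr1 in L1 L2.
apply: (squeeze_cvgr _ L1 L2); near=> m; have /andP[lo hi] := hb m.
have M0 : 0 < ((m + C.+1)%:R : R) ^+ d by rewrite exprn_gt0 // ltr0n addnS.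
apply/andP; split.
  by apply: le_trans (ler_wpM2l (ltW M0) lo); rewrite mulrCA expr_div_n.
apply: le_trans (ler_wpM2l (ltW M0) hi) _.
by rewrite addnS -addSn addnK expr_div_n invf_div mulrCA.
Unshelve. all: by end_near. Qed.

Theorem theorem1p2 (R : realType) (r n d N : nat)
  (A : 'M[int]_(r, n)) (b : 'cV[int]_r)
  (F : 'I_N -> fterm R[i] n) (beta : 'cV[int]_n)
  (P_bounded : bounded_set (polytope R A b))
  (P_dim : has_dim (polytope R A b) d)
  (vol_exists : cvgn (lattice_density d (polytope R A b)))
  (F_nfac : forall i, (nfac (F i) <= d.+1)%N)
  (F_sum : series_eq_ratfun (ehrhart_series R[i] (polytope R A b))
             (\sum_(i < N) fterm_ratfun (F i)))
  (beta_adm : forall i, admissible beta (F i)) :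
  (rel_vol d (polytope R A b))%:C%C =
    (d`!)%:R^-1 * \sum_(i < N) alg_vol d beta (F i) :> R[i].
Proof.
set v := rel_vol d _.
have [C0 hC0] := pairing_dilate_bound beta P_bounded.
pose C1 := (\max_(i < N) \max_(k < nfac (F i)) `|pairing beta (fnu k)|)%N.
have hC1 i (k : 'I_(nfac (F i))) : (`|pairing beta (fnu k)| <= C1)%N.
  apply: leq_trans (leq_bigmax i).
  exact: (leq_bigmax (F := fun k : 'I_(nfac (F i)) => `|pairing beta (fnu k)|%N) k).
(* [C0] serves the squeeze of the series and [C1] keeps all exponents nonzero; every $M = m + C + 1$
   meets both needs. *)
pose C := maxn C0 C1.
have hC s (a : multinom n) : a \in fset_set
      [set a : multinom n | dilate s (polytope R A b) (\col_(j < n) (a j)%:R)] ->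
    `|\sum_(j < n) beta j 0 * (a j)%:Z| <= (C * s)%:Z.
  move=> /hC0 /le_trans; apply; rewrite lez_nat leq_mul2r leq_maxl orbT //.
have bnd := beta_sum_bounds hC.
have adm m i (k : 'I_(nfac (F i))) : beta_exponent beta (m + C.+1) (fnu k) (fexp k) != 0.
  apply: beta_exponent_neq0; first exact: beta_adm.
  by rewrite addnS ltnS (leq_trans (hC1 i k)) // (leq_trans (leq_maxr C0 C1)) // leq_addl.
have CM m : (C < m + C.+1)%N by rewrite addnS ltnS leq_addl.
have /choice [h hh] : forall m, exists h : R,
  \sum_(i < N) (if nfac (F i) == d.+1 then laurent_at1 (fnum (F i)) /
     \prod_(k < nfac (F i)) (beta_exponent beta (m + C.+1) (fnu k) (fexp k))%:~R else 0) = h%:C%C /\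
  d`!%:R * v / (m + C.+1 + C)%:R ^+ d.+1 <= h <= d`!%:R * v / (m + C.+1 - C)%:R ^+ d.+1.
  move=> m; have [h hE hb] := sum_residues_bounds vol_exists F_nfac F_sum bnd (CM m) (@adm m).
  by exists h.
have hcvg := cvg_scaled_squeeze (fun m => (hh m).2).
pose x m : (R[i] : numFieldType) := ((m + C.+1)%:R : R[i])^-1.
have x0 m : x m != 0 by rewrite invr_eq0 pnatr_eq0 addnS.
have xcvg : x m @[m --> \oo] --> (0 : (R[i] : numFieldType)).
  have L : ((m + C.+1)%:R : R)^-1 @[m --> \oo] --> (0 : R).
    have := @cvg_harmonic R; rewrite -(cvg_shiftn C); apply: cvg_trans.
    by apply: near_eq_cvg; near=> m; rewrite /= addnS.
  have := cvg_real_complex L; apply: cvg_trans; apply: near_eq_cvg; near=> m.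
  by rewrite /x fmorphV rmorph_nat.
pose g i : {poly R[i]} := \prod_(k < nfac (F i))
  ((fexp k)%:~R%:P - (pairing beta (fnu k))%:~R *: 'X).
have g0 i : nfac (F i) == d.+1 -> g i != 0.
  by move=> _; apply/prodf_neq0 => k _; apply: beta_factor_neq0; exact: beta_adm.
have -> : \sum_(i < N) alg_vol d beta (F i) = (d`!%:R * v)%:C%C; last first.
  by rewrite rmorphM rmorph_nat mulrA mulVf ?mul1r // pnatr_eq0 -lt0n fact_gt0.
rewrite /alg_vol -big_mkcond /=.
apply: (sum_CT_of_cvg xcvg x0 (p := fun i => (laurent_at1 (fnum (F i)))%:P) g0).
have := cvg_real_complex hcvg; apply: cvg_trans; apply: near_eq_cvg; near=> m.
rewrite rmorphM rmorphXn rmorph_nat /= -(hh m).1 mulr_sumr [RHS]big_mkcond /=.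
apply: eq_bigr => i _; case: eqP => [di|_]; last by rewrite mulr0.
(* Each of the $d + 1$ factors contributes a denominator $M$, which accounts for the scaling by
   $M^{d+1}$. *)
rewrite hornerC horner_prod mulrCA; congr (_ * _).
rewrite [in RHS](eq_bigr (fun k => (beta_exponent beta (m + C.+1) (fnu k) (fexp k))%:~R /
   (m + C.+1)%:R)); last by move=> k _; apply: horner_beta_factor; rewrite addnS.
by rewrite prodf_div prodr_const card_ord invf_div -di.
Unshelve. all: by end_near. Qed.
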